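(* Consider a cable-driven robot with generalized coordinates $\mathbf q\in\mathbb R^n$; let $\tilde q$ be one of the coordinates, which is either an orientation variable or a translation variable, and keep all other coordinates $\bm\kappa=\mathbf q\setminus\{\tilde q\}$ constant. Set $u=\tan(\tilde q/2)$, $\rho=u^2+1$ if $\tilde q$ is an orientation variable, and $u=\tilde q$, $\rho=1$ if $\tilde q$ is a translation variable. Let $\mathbf s_i$ be the vector of cable segment $i$ with starting attachment point $A_{is}$, and consider a triangle $j$ of an obstacle with vertices $V_{j0},V_{j1},V_{j2}$ fixed in the global frame. Let $\mathbf e_{j1}={}^0\mathbf r_{P_0V_{j1}}-{}^0\mathbf r_{P_0V_{j0}}$, $\mathbf e_{j2}={}^0\mathbf r_{P_0V_{j2}}-{}^0\mathbf r_{P_0V_{j0}}$, $\mathbf e_{ij}={}^0\mathbf r_{P_0A_{is}}-{}^0\mathbf r_{P_0V_{j0}}$ and define $$d=\det[-\mathbf s_i,\mathbf e_{j1},\mathbf e_{j2}],\quad n_k=\det[\mathbf e_{ij},\mathbf e_{j1},\mathbf e_{j2}],\quad n_{k_1}=\det[-\mathbf s_i,\mathbf e_{ij},\mathbf e_{j2}],\quad n_{k_2}=\det[-\mathbf s_i,\mathbf e_{j1},\mathbf e_{ij}].$$ Then these terms can be expressed as $$d=\frac{\tilde d(u)}{\rho},\qquad n_k=\frac{\tilde n_k(u)}{\rho},\qquad n_{k_1}=\frac{\tilde n_{k_1}(u)}{\rho^2},\qquad n_{k_2}=\frac{\tilde n_{k_2}(u)}{\rho^2},$$ where $\tilde d,\tilde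 n_k,\tilde n_{k_1},\tilde n_{k_2}$ are univariate polynomials in $u$ (with coefficients not depending on $\tilde q$). If $\tilde q$ is an orientation variable, then $\tilde d,\tilde n_k\in O(u^2)$ and $\tilde n_{k_1},\tilde n_{k_2}\in O(u^4)$; if $\tilde q$ is a translation variable, then $\tilde d,\tilde n_k\in O(u)$ and $\tilde n_{k_1},\tilde n_{k_2}\in O(u^2)$.
   Context: Notation: $O(u^k)$ denotes the set of univariate polynomials in $u$ of degree at most $k$; ${}^0\mathbf r_{P_0X}$ is the position vector of a point $X$ in the global frame $\{0\}$ with origin $P_0$. Kinematic model. The robot consists of a fixed base (link $0$) and $p$ rigid links connected in a serial open chain by passive joints. The generalized coordinates are $\mathbf q=[\mathbf q_1^T,\dots,\mathbf q_p^T]^T\in\mathbb R^n$, where $\mathbf q_w$ are the coordinates of link $w$. ${}^aR_b$ is the rotation matrix from frame $\{b\}$ to frame $\{a\}$, ${}^0R_0=I$, and ${}^0R_k={}^0R_1\,{}^1R_2\cdots{}^{k-1}R_k$. ${}^c\mathbf r_{P_cP_{c+1}}$ is the vector from the start $P_c$ of link $c$ to the start $P_{c+1}$ of link $c+1$, expressed in frame $\{c\}$. Cable segment $i$, attached from link $s$ to link $e$ ($s<e$, $s,e\in\{0,\dots,p\}$), has starting point $A_{is}$ on link $s$ and end point $A_{ie}$ on link $e$, with relative position vectors ${}^s\mathbf r_{P_sA_{is}}$ and ${}^e\mathbf r_{P_eA_{ie}}$ in the local frames. Absolute positions are $${}^0\mathbf r_{P_0A_{is}}=\sum_{k=0}^{s-1}{}^0R_k\,{}^k\mathbf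 r_{P_kP_{k+1}}+{}^0R_s\,{}^s\mathbf r_{P_sA_{is}},\qquad {}^0\mathbf r_{P_0A_{ie}}=\sum_{k=0}^{e-1}{}^0R_k\,{}^k\mathbf r_{P_kP_{k+1}}+{}^0R_e\,{}^e\mathbf r_{P_eA_{ie}},$$ and the segment vector is $\mathbf s_i={}^0\mathbf r_{P_0A_{ie}}-{}^0\mathbf r_{P_0A_{is}}$. Orientation variable: $\tilde q\in\mathbf q_w$ enters the model only through the rotation matrix ${}^{w-1}R_w$, each entry of which is a polynomial of degree at most 1 in $(\cos\tilde q,\sin\tilde q)$ with coefficients depending only on $\bm\kappa$; all other relative rotation matrices and all link and attachment vectors do not depend on $\tilde q$; $\tilde q$ is not an odd multiple of $\pi$. Translation variable: $\tilde q$ enters the model only through a link vector of the form ${}^c\mathbf r_{P_cP_{c+1}}$, each component of which is a polynomial of degree at most 1 in $\tilde q$; all rotation matrices and all attachment vectors do not depend on $\tilde q$. *)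

(* Defs.v *)
From HB Require Import structures.
From mathcomp Require Import all_boot all_order all_algebra.
From mathcomp Require Import all_classical all_reals all_analysis.
Set Implicit Arguments.
Unset Strict Implicit.
Unset Printing Implicit Defensive.
Import Order.TTheory GRing.Theory Num.Theory.
Local Open Scope ring_scope.

Section Model.
Variables (R : realType) (p : nat) (dimq : 'I_p -> nat).

(* Links are numbered from 1 and indices w : 'I_p from 0, so w stands for link
   w + 1: dimq w is the number of coordinates of link w + 1, and a
   configuration stacks these p blocks of coordinates.  Frames 0, ..., p are
   indexed by 'I_p.+1. *)
Definition config : Type := 'cV[R]_(\sum_(w < p) dimq w).
Definition coord_index : Type := 'I_(\sum_(w < p) dimq w).

Record cdpr := CDPR {
  (* relrot w is the rotation matrix from frame {w + 1} to frame {w}. *)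
  relrot : 'I_p -> config -> 'M[R]_3;
  relrot_rotation : forall w q,
    (relrot w q)^T *m relrot w q = 1%:M /\ \det (relrot w q) = 1;
  (* linkv c is the vector from P_c to P_(c + 1) in frame {c}. *)
  linkv : 'I_p -> config -> 'cV[R]_3;
  nseg : nat;
  seg_s : 'I_nseg -> 'I_p.+1;
  seg_e : 'I_nseg -> 'I_p.+1;
  seg_lt : forall i, (seg_s i < seg_e i)%N;
  (* Attachment points A_is and A_ie relative to the start of their link, in
     the frame of that link. *)
  att_s : 'I_nseg -> config -> 'cV[R]_3;
  att_e : 'I_nseg -> config -> 'cV[R]_3
}.

Variable M : cdpr.

Definition absrot (k : nat) (q : config) : 'M[R]_3 :=
  \prod_(w < p | (w < k)%N) relrot M w q.

Definition abspos (k : nat) (r : 'cV[R]_3) (q : config) : 'cV[R]_3 :=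
  \sum_(c < p | (c < k)%N) absrot c q *m linkv M c q + absrot k q *m r.

Definition pos_start (i : 'I_(nseg M)) (q : config) : 'cV[R]_3 :=
  abspos (seg_s i) (att_s i q) q.

Definition pos_end (i : 'I_(nseg M)) (q : config) : 'cV[R]_3 :=
  abspos (seg_e i) (att_e i q) q.

Definition segv (i : 'I_(nseg M)) (q : config) : 'cV[R]_3 :=
  pos_end i q - pos_start i q.

Definition set_coord (q : config) (j : coord_index) (t : R) : config :=
  \col_k (if k == j then t else q k 0).

Definition indep (T : Type) (j : coord_index) (f : config -> T) : Prop :=
  forall q t, f (set_coord q j t) = f q.

Definition attachments_indep (j : coord_index) : Prop :=
  forall i : 'I_(nseg M), indep j (att_s i) /\ indep j (att_e i).

(* Coordinate j belongs to block tagnat.sig1 j.  Excluding the odd multiples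
   of pi is a condition on the value of the coordinate: see admissible. *)
Definition orientation_coord (j : coord_index) : Prop :=
  [/\ forall a b : 'I_3, exists c0 c1 c2 : config -> R,
        [/\ indep j c0, indep j c1, indep j c2 &
            forall q, relrot M (tagnat.sig1 j) q a b
                      = c0 q + c1 q * cos (q j 0) + c2 q * sin (q j 0)],
      forall w, w != tagnat.sig1 j -> indep j (relrot M w),
      forall c, indep j (linkv M c)
    & attachments_indep j].

Definition translation_coord (j : coord_index) : Prop :=
  exists c : 'I_p,
  [/\ forall a : 'I_3, exists c0 c1 : config -> R,
        [/\ indep j c0, indep j c1 &
            forall q, linkv M c q a 0 = c0 q + c1 q * q j 0],
      forall c', c' != c -> indep j (linkv M c'),
      forall w, indep j (relrot M w)
    & attachments_indep j].

End Model.

Inductive coord_kind := Orientation | Translation.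

Definition has_kind (R : realType) (p : nat) (dimq : 'I_p -> nat)
    (M : cdpr R dimq) (kd : coord_kind) (j : coord_index dimq) : Prop :=
  match kd with
  | Orientation => orientation_coord M j
  | Translation => translation_coord M j
  end.

Definition admissible (R : realType) (kd : coord_kind) (t : R) : Prop :=
  match kd with
  | Orientation => forall k : int, t <> (2 * k + 1)%:~R * pi
  | Translation => True
  end.

Definition uvar (R : realType) (kd : coord_kind) (t : R) : R :=
  match kd with
  | Orientation => tan (t / 2)
  | Translation => t
  end.

Definition rho (R : realType) (kd : coord_kind) (t : R) : R :=
  match kd with
  | Orientation => uvar kd t ^+ 2 + 1
  | Translation => 1
  end.

Definition deg_le (R : realType) (k : nat) (f : {poly R}) : Prop :=
  (size f <= k.+1)%N.

Definition det3 (R : realType) (x y z : 'cV[R]_3) : R :=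
  \det (\matrix_(a < 3, b < 3) (tnth [tuple x; y; z] b) a 0).

(* Main.v *)
(* In the half-angle variable u, cos and sin are polynomials of degree at most 2
   over rho = u^2 + 1.  A position involves the moving coordinate through a
   single factor of each product (one rotation, or one link vector), so all
   positions have the form P(u) / rho with one fixed degree bound, and constants
   can be brought to this form by multiplying by rho / rho.  A determinant is
   multilinear, so its denominators and degrees add up over the columns that
   depend on the coordinate. *)
Require Import Defs.
From HB Require Import structures.
From mathcomp Require Import all_boot all_order all_algebra.
From mathcomp Require Import all_classical all_reals all_analysis.
From mathcomp Require Import perm ring lra.
Set Implicit Arguments.
Unset Strict Implicit.
Unset Printing Implicit Defensive.
Import Order.TTheory GRing.Theory Num.Theory.
Local Open Scope ring_scope.

(** * Zeros of the cosine *)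

Lemma sin_mulz_pi (R : realType) (n : int) : sin (n%:~R * pi) = 0 :> R.
Proof.
have H (m : nat) : sin (m%:R * pi) = 0 :> R.
  by rewrite mulr_natl -[_ *+ _]add0r (alternatingn (@sinDpi R)) sin0 mulr0.
case: n => n; first by rewrite -pmulrn H.
by rewrite NegzE mulrNz mulNr sinN -pmulrn H oppr0.
Qed.

(** Subtracting a multiple of [pi] moves [x] into the interval from 0 to [pi], where the cosine is
    injective, so the remainder can only be [pi / 2]. The conclusion concerns [x *+ 2] because the
    lemma serves at half angles. *)
Lemma cos_eq0 (R : realType) (x : R) :
  cos x = 0 -> exists k : int, x *+ 2 = (2 * k + 1)%:~R * pi.
Proof.
move=> cx0; have pi0 := pi_gt0 R; set n := Num.floor (x / pi).
pose y := x - n%:~R * pi.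
have cy0 : cos y = 0 by rewrite cosB cx0 sin_mulz_pi mul0r mulr0 addr0.
have /andP[y0 ypi] : 0 <= y < pi.
  have /andP[h1 h2] := floor_itv (x / pi).
  rewrite subr_ge0 -ler_pdivlMr // h1 ltrBlDl -[ltRHS]/(_ + pi).
  by move: h2; rewrite ltr_pdivrMr // intrD mulrDl mul1r.
have yE : y = pi / 2.
  apply: cos_inj; rewrite ?in_itv /= ?y0 ?(ltW ypi) ?cy0 ?cos_pihalf //.
  by apply/andP; split; lra.
exists n; have -> : x = pi / 2 + n%:~R * pi by rewrite -yE subrK.
by rewrite intrD intrM; field.
Qed.

(** * Functions that are polynomials in u over a power of rho *)

(** Numerator degree allowed per unit of order: sine and cosine are quadratic in the half-angle
    variable over [rho], while a translation variable is linear in itself. *)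
Definition unit_deg (kd : coord_kind) : nat :=
  match kd with Orientation => 2 | Translation => 1 end.

(* The single index [m] tracks both the power of [rho] in the denominator and
   the degree of the numerator; for a translation, where [rho = 1], only the
   degree is meaningful. *)
Definition has_order (R : realType) (kd : coord_kind) (m : nat) (f : R -> R) :=
  exists2 P : {poly R}, deg_le (unit_deg kd * m) P &
    forall t, admissible kd t -> f t * rho kd t ^+ m = P.[uvar kd t].

Definition mx_has_order (R : realType) (kd : coord_kind) (m : nat) (a b : nat)
    (F : R -> 'M[R]_(a, b)) :=
  forall i j, has_order kd m (fun t => F t i j).

Lemma rho_neq0 (R : realType) kd (t : R) : rho kd t != 0.
Proof.
by case: kd => /=; rewrite ?oner_neq0 // gt_eqF // ltr_wpDl ?sqr_ge0.
Qed.

Section Order.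
Context {R : realType} {kd : coord_kind}.
Implicit Types (f g : R -> R) (m : nat).

Lemma deg_leM d1 d2 (P Q : {poly R}) :
  deg_le d1 P -> deg_le d2 Q -> deg_le (d1 + d2) (P * Q).
Proof.
rewrite /deg_le => hP hQ; apply: leq_trans (size_polyMleq _ _) _.
by rewrite -subn1 leq_subLR add1n -addnS -addSn leq_add.
Qed.

Lemma has_order_eq m f g : f =1 g -> has_order kd m f -> has_order kd m g.
Proof. by move=> fg [P dP PE]; exists P => // t /PE; rewrite fg. Qed.

Lemma has_order_cst (c : R) : has_order kd 0 (fun=> c).
Proof.
exists c%:P; first by rewrite /deg_le muln0 size_polyC leq_b1.
by move=> t _; rewrite expr0 mulr1 hornerC.
Qed.

Lemma has_orderD m f g : has_order kd m f -> has_order kd m g ->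
  has_order kd m (fun t => f t + g t).
Proof.
move=> [P dP PE] [Q dQ QE]; exists (P + Q) => [|t ta].
  by rewrite /deg_le (leq_trans (size_polyD _ _)) // geq_max dP.
by rewrite mulrDl hornerD PE ?QE.
Qed.

Lemma has_orderM m1 m2 f g : has_order kd m1 f -> has_order kd m2 g ->
  has_order kd (m1 + m2) (fun t => f t * g t).
Proof.
move=> [P dP PE] [Q dQ QE]; exists (P * Q) => [|t ta].
  by rewrite mulnDr; exact: deg_leM.
by rewrite hornerM -PE // -QE // exprD mulrACA.
Qed.

(** Multiplying by the constant 1, seen as [rho / rho], raises the order by one. This brings
    summands of different orders to a common one. *)
Lemma has_order_succ m f : has_order kd m f -> has_order kd m.+1 f.
Proof.
suff h1 : has_order kd 1 (fun=> 1 : R).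
  move=> /has_orderM /(_ h1); rewrite addn1.
  by apply: has_order_eq => t; rewrite mulr1.
rewrite /has_order /deg_le muln1.
(* The witness is [rho] itself, written as a polynomial in u. *)
exists (match kd with Orientation => 'X^2 + 1 | Translation => 1 end).
  by case: kd; rewrite ?size_XnaddC // size_poly1.
by move=> t _; case: kd => /=; rewrite ?hornerE /= ?expr1 ?mul1r ?hornerE.
Qed.

Lemma has_order_leq {m} n {f} : (m <= n)%N -> has_order kd m f -> has_order kd n f.
Proof.
move=> /subnK <- hf; elim: (n - m)%N => // l IH; rewrite addSn.
exact: has_order_succ.
Qed.

Lemma has_order_sum (I : Type) (r : seq I) (Q : pred I) m (F : I -> R -> R) :
  (forall i, Q i -> has_order kd m (F i)) ->
  has_order kd m (fun t => \sum_(i <- r | Q i) F i t).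
Proof.
move=> hF; elim: r => [|i r IH].
  apply: (@has_order_eq _ (fun=> 0)); first by move=> t; rewrite big_nil.
  exact: has_order_leq (leq0n m) (has_order_cst 0).
case Qi: (Q i); last by apply: has_order_eq IH => t; rewrite big_cons Qi.
apply: (@has_order_eq _ (fun t => F i t + \sum_(i <- r | Q i) F i t)).
  by move=> t; rewrite big_cons Qi.
exact: has_orderD (hF _ Qi) IH.
Qed.

Lemma has_order_prod (I : Type) (r : seq I) (m : I -> nat) (F : I -> R -> R) :
  (forall i, has_order kd (m i) (F i)) ->
  has_order kd (\sum_(i <- r) m i) (fun t => \prod_(i <- r) F i t).
Proof.
move=> hF; elim: r => [|i r IH].
  apply: (@has_order_eq _ (fun=> 1)); first by move=> t; rewrite big_nil.
  rewrite big_nil; exact: has_order_cst.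
rewrite big_cons.
apply: (@has_order_eq _ (fun t => F i t * \prod_(i <- r) F i t)).
  by move=> t; rewrite big_cons.
exact: has_orderM.
Qed.

(** Each term of the Leibniz expansion takes exactly one entry from every column, so all terms share
    the same order, the sum of the column orders. *)
Lemma has_order_det n (m : 'I_n -> nat) (A : R -> 'M[R]_n) :
  (forall a b, has_order kd (m b) (fun t => A t a b)) ->
  has_order kd (\sum_b m b) (fun t => \det (A t)).
Proof.
move=> hA; apply: has_order_sum => s _.
rewrite -[(\sum_b _)%N]add0n; apply: has_orderM (has_order_cst _) _.
(* Row [a] contributes its entry in column [s a]; summing the orders along [s] makes summand and
   factor correspond. *)
rewrite (reindex_inj (@perm_inj _ s)) /=.
exact: has_order_prod.
Qed.

Lemma has_order_det3 m1 m2 m3 (x y z : R -> 'cV[R]_3) :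
  mx_has_order kd m1 x -> mx_has_order kd m2 y -> mx_has_order kd m3 z ->
  has_order kd (m1 + m2 + m3) (fun t => det3 (x t) (y t) (z t)).
Proof.
move=> hx hy hz.
have -> : (m1 + m2 + m3 = \sum_(b < 3) tnth [tuple m1; m2; m3] b)%N.
  by rewrite !big_ord_recl big_ord0 addn0 addnA.
apply: has_order_det => a b.
case: b => [[|[|[|//]]] hb].
- by apply: has_order_eq (hx a 0) => t; rewrite mxE.
- by apply: has_order_eq (hy a 0) => t; rewrite mxE.
- by apply: has_order_eq (hz a 0) => t; rewrite mxE.
Qed.

Lemma mx_has_order_cst a b (A : 'M[R]_(a, b)) : mx_has_order kd 0 (fun=> A).
Proof. by move=> i j; exact: has_order_cst. Qed.

Lemma mx_has_orderD m a b (F G : R -> 'M[R]_(a, b)) :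
  mx_has_order kd m F -> mx_has_order kd m G ->
  mx_has_order kd m (fun t => F t + G t).
Proof.
move=> hF hG i j; apply: has_order_eq (has_orderD (hF i j) (hG i j)).
by move=> t; rewrite mxE.
Qed.

Lemma mx_has_orderN m a b (F : R -> 'M[R]_(a, b)) :
  mx_has_order kd m F -> mx_has_order kd m (fun t => - F t).
Proof.
move=> hF i j.
apply: has_order_eq (has_orderM (has_order_cst (-1)) (hF i j)).
by move=> t; rewrite mxE mulN1r.
Qed.

Lemma mx_has_orderM m1 m2 a b c (F : R -> 'M[R]_(a, b)) (G : R -> 'M[R]_(b, c)) :
  mx_has_order kd m1 F -> mx_has_order kd m2 G ->
  mx_has_order kd (m1 + m2) (fun t => F t *m G t).
Proof.
move=> hF hG i j.
apply: (@has_order_eq _ (fun t => \sum_k F t i k * G t k j)).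
  by move=> t; rewrite mxE.
by apply: has_order_sum => k _; exact: has_orderM.
Qed.

Lemma mx_has_order_leq {m} n {a b} {F : R -> 'M[R]_(a, b)} :
  (m <= n)%N -> mx_has_order kd m F -> mx_has_order kd n F.
Proof. by move=> mn hF i j; exact: has_order_leq mn (hF i j). Qed.

Lemma mx_has_order_eq m a b (F G : R -> 'M[R]_(a, b)) :
  F =1 G -> mx_has_order kd m F -> mx_has_order kd m G.
Proof. by move=> FG hF i j; apply: has_order_eq (hF i j) => t; rewrite FG. Qed.

Lemma mx_has_order_sum (I : Type) (r : seq I) (Q : pred I) m a b
    (F : I -> R -> 'M[R]_(a, b)) :
  (forall i, Q i -> mx_has_order kd m (F i)) ->
  mx_has_order kd m (fun t => \sum_(i <- r | Q i) F i t).
Proof.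
move=> hF i j.
apply: (@has_order_eq _ (fun t => \sum_(k <- r | Q k) F k t i j)).
  by move=> t; rewrite summxE.
by apply: has_order_sum => k Qk; exact: hF.
Qed.

Lemma mx_has_order_prod (I : Type) (r : seq I) (Q : pred I) (m : I -> nat) n
    (F : I -> R -> 'M[R]_n.+1) :
  (forall i, mx_has_order kd (m i) (F i)) ->
  mx_has_order kd (\sum_(i <- r | Q i) m i) (fun t => \prod_(i <- r | Q i) F i t).
Proof.
move=> hF; elim: r => [|i r IH].
  rewrite big_nil; apply: mx_has_order_eq (mx_has_order_cst 1) => t.
  by rewrite big_nil.
rewrite big_cons; case Qi: (Q i); last first.
  by apply: mx_has_order_eq IH => t; rewrite big_cons Qi.
apply: mx_has_order_eq (mx_has_orderM (hF i) IH) => t.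
by rewrite big_cons Qi.
Qed.

End Order.

(** * Half-angle substitution *)

Lemma admissible_cos_half (R : realType) (t : R) :
  admissible Orientation t -> cos (t / 2) != 0.
Proof.
(* A zero at [t / 2] would make [t] an odd multiple of [pi], which admissibility excludes. *)
move=> ta; apply/eqP => /cos_eq0 [k].
by rewrite -[_ *+ 2]mulr_natr divfK ?pnatr_eq0 //; exact: ta.
Qed.

(** This is [cos t = (1 - u^2) / (1 + u^2)], from the double-angle formula. *)
Lemma cos_has_order (R : realType) : has_order Orientation 1 (@cos R).
Proof.
exists (1 - 'X^2) => [|t ta].
  by rewrite /deg_le -opprB size_polyN size_XnsubC.
rewrite /= expr1 !hornerE /=.
have c0 := admissible_cos_half ta.
have {1}-> : t = (t / 2) *+ 2 by rewrite -[_ *+ 2]mulr_natr divfK ?pnatr_eq0.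
(* Here [rho] becomes the inverse square of [cos (t / 2)], leaving an identity of rational
   functions. *)
rewrite cos_mulr2n [_ ^+ 2 + 1]addrC -cos2_tan2 //.
rewrite /tan expr_div_n sin2cos2; field.
exact: c0.
Qed.

(** This is [sin t = 2 u / (1 + u^2)]. *)
Lemma sin_has_order (R : realType) : has_order Orientation 1 (@sin R).
Proof.
exists (2%:P * 'X) => [|t ta].
  by rewrite /deg_le (leq_trans (size_polyMleq _ _)) // size_polyX addn2 /=
     ltnS (leq_trans (size_polyC_leq1 _)).
rewrite /= expr1 !hornerE /=.
have c0 := admissible_cos_half ta.
have {1}-> : t = (t / 2) *+ 2 by rewrite -[_ *+ 2]mulr_natr divfK ?pnatr_eq0.
rewrite sin_mulr2n [_ ^+ 2 + 1]addrC -cos2_tan2 // /tan; field.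
exact: c0.
Qed.

Lemma id_has_order (R : realType) : has_order Translation 1 (@id R).
Proof. by exists 'X => [|t _]; rewrite ?/deg_le ?size_polyX //= hornerX expr1 mulr1. Qed.

(** * Orders of absolute positions along the chain *)

Section Model.
Context {R : realType} {p : nat} {dimq : 'I_p -> nat} {M : cdpr R dimq}.
Context {j : coord_index dimq}.

Lemma set_coordE (q : config R dimq) (t : R) : set_coord q j t j 0 = t.
Proof. by rewrite mxE eqxx. Qed.

Lemma indep_mx_has_order kd m n (F : config R dimq -> 'M[R]_(m, n)) q :
  indep j F -> mx_has_order kd 0 (fun t => F (set_coord q j t)).
Proof.
move=> hF; apply: mx_has_order_eq (mx_has_order_cst (F q)) => t.
by rewrite hF.
Qed.

(* Order [1] may be spent either on rotations ([m = 1]) or on link vectors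
   ([m = 0]); either way every absolute position has order [1]. *)
Lemma abspos_has_order kd (w0 : 'I_p) m (k : nat) (r : config R dimq -> 'cV[R]_3) q :
  (m <= 1)%N ->
  (forall w, mx_has_order kd (m * (w == w0)) (fun t => relrot M w (set_coord q j t))) ->
  (forall c, mx_has_order kd (1 - m) (fun t => linkv M c (set_coord q j t))) ->
  indep j r ->
  mx_has_order kd 1 (fun t => abspos M k (r (set_coord q j t)) (set_coord q j t)).
Proof.
move=> m1 hrot hlink hr.
have habs l : mx_has_order kd m (fun t => absrot M l (set_coord q j t)).
  apply: mx_has_order_leq (mx_has_order_prod _ _ hrot).
  (* Only the factor [w0] can add to the order, and it occurs at most once in the product. *)
  rewrite -big_distrr /= -[leqRHS]muln1 leq_mul2l; apply/orP; right.
  rewrite big_mkcond (bigD1 w0) //= big1 ?addn0 => [|w /negPf ->].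
    by case: ifP; rewrite ?leq_b1.
  by case: ifP.
(* Order 1 is split as [m] for the rotation plus [1 - m] for the vector it acts on. *)
rewrite -[X in mx_has_order _ X](subnKC m1); apply: mx_has_orderD.
  by apply: mx_has_order_sum => c _; exact: mx_has_orderM.
apply: mx_has_orderM => //.
exact: mx_has_order_leq (leq0n _) (indep_mx_has_order _ q hr).
Qed.

Lemma has_kind_abspos kd (k : nat) (r : config R dimq -> 'cV[R]_3) q :
  has_kind M kd j -> indep j r ->
  mx_has_order kd 1 (fun t => abspos M k (r (set_coord q j t)) (set_coord q j t)).
Proof.
case: kd => /= [[hrot hrot' hlink _]|[c [hlink hlink' hrot _]]] hr.
  (* Orientation: the order is spent on the one rotation that moves. *)
  apply: (@abspos_has_order _ (tagnat.sig1 j) 1) => // [w|l]; last first.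
    exact: indep_mx_has_order.
  have [->|/hrot'] := eqVneq w (tagnat.sig1 j); last exact: indep_mx_has_order.
  move=> a b; have [c0 [c1 [c2 [h0 h1 h2 E]]]] := hrot a b.
  (* By independence the coefficients can be evaluated at the fixed [q], so they are constants in
     [t]. *)
  apply: (@has_order_eq _ _ _ (fun t => c0 q + c1 q * cos t + c2 q * sin t)).
    by move=> t; rewrite E set_coordE h0 h1 h2.
  apply: has_orderD; first apply: has_orderD.
  - exact: has_order_succ (has_order_cst _).
  - exact: (has_orderM (has_order_cst _) (@cos_has_order R)).
  - exact: (has_orderM (has_order_cst _) (@sin_has_order R)).
(* Translation: the order is spent on the link vector that moves. *)
apply: (@abspos_has_order _ c 0) => // [w|l]; first exact: indep_mx_has_order.
have [->|/hlink' hl] := eqVneq l c; last first.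
  exact: mx_has_order_leq (indep_mx_has_order _ q hl).
move=> a b; rewrite ord1; have [c0 [c1 [h0 h1 E]]] := hlink a.
apply: (@has_order_eq _ _ _ (fun t => c0 q + c1 q * t)).
  by move=> t; rewrite E set_coordE h0 h1.
apply: has_orderD; first exact: has_order_succ (has_order_cst _).
exact: (has_orderM (has_order_cst _) (@id_has_order R)).
Qed.

Lemma has_kind_attachments kd : has_kind M kd j -> attachments_indep M j.
Proof. by case: kd => /= [[]|[c []]]. Qed.

End Model.

Theorem corollary2 (R : realType) (p : nat) (dimq : 'I_p -> nat)
    (M : cdpr R dimq) (j : coord_index dimq) (kd : coord_kind)
    (hkd : has_kind M kd j) (i : 'I_(nseg M)) (V0 V1 V2 : 'cV[R]_3)
    (q : config R dimq) :
  let e1 := V1 - V0 in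
  let e2 := V2 - V0 in
  let s := fun t : R => segv i (set_coord q j t) in
  let e := fun t : R => pos_start i (set_coord q j t) - V0 in
  exists pd pn pn1 pn2 : {poly R},
  [/\ forall t : R, admissible kd t ->
        let u := uvar kd t in
        [/\ det3 (- s t) e1 e2 = pd.[u] / rho kd t,
            det3 (e t) e1 e2 = pn.[u] / rho kd t,
            det3 (- s t) (e t) e2 = pn1.[u] / rho kd t ^+ 2
          & det3 (- s t) e1 (e t) = pn2.[u] / rho kd t ^+ 2],
      kd = Orientation ->
        [/\ deg_le 2 pd, deg_le 2 pn, deg_le 4 pn1 & deg_le 4 pn2]
    & kd = Translation ->
        [/\ deg_le 1 pd, deg_le 1 pn, deg_le 2 pn1 & deg_le 2 pn2]].
Proof.
move=> e1 e2 s e.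
have [hAs hAe] := has_kind_attachments hkd i.
have hstart := has_kind_abspos (seg_s i) q hkd hAs.
have hs : mx_has_order kd 1 (fun t => - s t).
  apply: mx_has_orderN; apply: mx_has_orderD (mx_has_orderN hstart).
  exact: has_kind_abspos.
(* The fixed vertex [V0] is raised from order 0 to order 1. *)
have he : mx_has_order kd 1 e.
  exact: mx_has_orderD hstart (mx_has_order_leq (leq0n 1) (mx_has_order_cst _)).
have h1 : mx_has_order kd 0 (fun=> e1) := mx_has_order_cst e1.
have h2 : mx_has_order kd 0 (fun=> e2) := mx_has_order_cst e2.
(* The edges have order 0, so the order of each determinant, and hence its power of [rho], is the
   number of columns among [- s] and [e]: one for [pd] and [pn], two for [pn1] and [pn2]. *)
have [pd dd Ed] := has_order_det3 hs h1 h2.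
have [pn dn En] := has_order_det3 he h1 h2.
have [pn1 dn1 En1] := has_order_det3 hs he h2.
have [pn2 dn2 En2] := has_order_det3 hs h1 he.
exists pd, pn, pn1, pn2; split=> [t ta u||].
- by rewrite -Ed // -En // -En1 // -En2 // !mulfK ?expf_neq0 ?rho_neq0.
(* For a concrete kind the bound [unit_deg kd] times the order computes to the stated degree. *)
- by move=> kdE; move: dd dn dn1 dn2; rewrite kdE.
- by move=> kdE; move: dd dn dn1 dn2; rewrite kdE.
Qed.
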